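(* Let $p$ be a prime, $n\ge 1$, let $C\subseteq \mathbf{F}_p^{2n}$ be a linear space with $C\subseteq C^\perp$, let $I\subseteq\{1,\dots,n\}$, and let $D$ be an arbitrary linear subspace of $C$. Then measurements of the observables defined by (a basis of) $D$ can correct erasures at $I$ on codewords in the stabilizer code $Q(C)$ if and only if $$C\cap \mathbf{F}_p^I = D^\perp\cap \mathbf{F}_p^I .$$
   Context: $\mathbf{F}_p$ is the field with $p$ elements. Vectors of $\mathbf{F}_p^{2n}$ are written $(a_1,\dots,a_n|b_1,\dots,b_n)$. The symplectic inner product is $\langle (a|b),(a'|b')\rangle=\sum_{i=1}^n (a_ib'_i-a'_ib_i)$ and $C^\perp$ is the orthogonal space with respect to it. For $J\subseteq\{1,\dots,n\}$, $\mathbf{F}_p^J=\{(a|b)\in\mathbf{F}_p^{2n}: a_i=b_i=0 \text{ if } i\notin J\}$. Let $\mathcal{H}_p$ be a $p$-dimensional complex space with orthonormal basis $|0\rangle,\dots,|p-1\rangle$, $X|i\rangle=|i+1 \bmod p\rangle$, $Z|i\rangle=\exp(2\pi\sqrt{-1}/p)^i|i\rangle$, and $M(a|b)=X^{a_1}Z^{b_1}\otimes\cdots\otimes X^{a_n}Z^{b_n}$ acting on $\mathcal{H}_p^{\otimes n}$. For $C\subseteq C^\perp$, the group $S$ generated by $\{M(\vec{x}):\vec{x}\in C\}$ is commutative; fix a common eigenvector of $S$ and let $\eta(U)$ be its eigenvalue for $U\in S$ (not required to be $+1$). The stabilizer code is $Q(C)=\{|\psi\rangle\in\mathcal{H}_p^{\otimes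 n}: U|\psi\rangle=\eta(U)|\psi\rangle \text{ for all } U\in S\}$. Measurement and correction. For $\vec{x}\in C$, the observable defined by $\vec{x}$ is one whose eigenspaces are those of $M(\vec{x})$. For an erasure vector $\vec{e}\in\mathbf{F}_p^I$ and a codeword $|\psi\rangle\in Q(C)$, measuring it on $M(\vec{e})|\psi\rangle$ gives a deterministic outcome equivalent to the value $\langle\vec{x},\vec{e}\rangle\in\mathbf{F}_p$. Measuring $D$ means measuring the observables of a basis $\vec{x}_1,\dots,\vec{x}_\ell$ of $D$, giving the syndrome $s(\vec{e})=(\langle \vec{x}_i,\vec{e}\rangle)_{i=1}^{\ell}$. These measurements ''can correct erasures at $I$ on codewords in $Q(C)$'' if for each syndrome $s\in\mathbf{F}_p^\ell$ there is a unitary $U_s$ such that for all $\vec{e}\in\mathbf{F}_p^I$ with $s(\vec{e})=s$ and all $|\psi\rangle\in Q(C)$, the vector $U_sM(\vec{e})|\psi\rangle$ equals $|\psi\rangle$ up to a scalar phase; equivalently, the syndrome $s(\vec{e})$ determines $\vec{e}\in\mathbf{F}_p^I$ uniquely modulo $C$. *)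

(* Defs.v *)
From HB Require Import structures.
From mathcomp Require Import all_boot all_order all_algebra.
From mathcomp Require Import complex.
From mathcomp Require Import reals trigo.

Set Implicit Arguments.
Unset Strict Implicit.
Unset Printing Implicit Defensive.

Import Order.TTheory GRing.Theory Num.Theory.
Local Open Scope ring_scope.

(* A vector (a|b) of F_p^{2n} is a row of width n + n: a is [lsubmx] and b is
   [rsubmx].  'F_p is the field with p elements only when p is prime; for p
   prime, the coercion 'F_p >-> nat takes values in {0, ..., p - 1}. *)
Definition sympl (p n : nat) (x y : 'rV['F_p]_(n + n)) : 'F_p :=
  \sum_(i < n) (lsubmx x 0 i * rsubmx y 0 i - lsubmx y 0 i * rsubmx x 0 i).

Definition perp (p n : nat) (C : {vspace 'rV['F_p]_(n + n)}) :
    {set 'rV['F_p]_(n + n)} :=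
  [set x | [forall y, (y \in C) ==> (sympl y x == 0)]].

(* The space F_p^J of vectors vanishing outside J. *)
Definition supported (p n : nat) (J : {set 'I_n}) :
    {set 'rV['F_p]_(n + n)} :=
  [set x | [forall i, (i \notin J) ==>
              (lsubmx x 0 i == 0) && (rsubmx x 0 i == 0)]].

(* The number of basis vectors |f> = |f 0> (x) ... (x) |f (n - 1)> of the
   n-fold tensor power of C^p; the k-th one is given by f = digits k.
   Operators act on column vectors. *)
Definition tdim (p n : nat) : nat := #|{: {ffun 'I_n -> 'I_p}}|.

Definition digits (p n : nat) (k : 'I_(tdim p n)) : {ffun 'I_n -> 'I_p} :=
  enum_val k.

Definition tensor (K : comPzRingType) (p n : nat) (A : 'I_n -> 'M[K]_p) :
    'M[K]_(tdim p n) :=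
  \matrix_(k, l) \prod_(i < n) A i (digits k i) (digits l i).

Definition zeta (R : realType) (p : nat) : R[i] :=
  Complex (cos (2 * pi / p%:R)) (sin (2 * pi / p%:R)).

(* [ordS j] is j + 1 mod p. *)
Definition shiftX (R : realType) (p : nat) : 'M[R[i]]_p :=
  \matrix_(i, j) (i == ordS j)%:R.

Definition phaseZ (R : realType) (p : nat) : 'M[R[i]]_p :=
  diag_mx (\row_i zeta R p ^+ i).

Definition weyl (R : realType) (p n : nat) (x : 'rV['F_p]_(n + n)) :
    'M[R[i]]_(tdim p n) :=
  tensor (fun i => shiftX R p ^+ lsubmx x 0 i *m phaseZ R p ^+ rsubmx x 0 i).

(* The group S of operators generated by the M(x), x in C. *)
Inductive stab_group (R : realType) (p n : nat)
    (C : {vspace 'rV['F_p]_(n + n)}) : 'M[R[i]]_(tdim p n) -> Prop :=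
| stab_gen x : x \in C -> stab_group C (weyl R x)
| stab_one : stab_group C 1%:M
| stab_mul U V : stab_group C U -> stab_group C V -> stab_group C (U *m V)
| stab_inv U : stab_group C U -> stab_group C (invmx U).

Definition stab_eigenvector (R : realType) (p n : nat)
    (C : {vspace 'rV['F_p]_(n + n)}) (eta : 'M[R[i]]_(tdim p n) -> R[i])
    (phi : 'cV[R[i]]_(tdim p n)) : Prop :=
  phi != 0 /\ forall U, stab_group C U -> U *m phi = eta U *: phi.

Definition stab_code (R : realType) (p n : nat)
    (C : {vspace 'rV['F_p]_(n + n)}) (eta : 'M[R[i]]_(tdim p n) -> R[i])
    (psi : 'cV[R[i]]_(tdim p n)) : Prop :=
  forall U, stab_group C U -> U *m psi = eta U *: psi.

(* On weyl R e *m psi with psi a codeword, weyl R x with x in C acts as a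
   scalar that is determined by, and determines, sympl x e: measuring the
   observable defined by x has a deterministic outcome, recorded as sympl x e. *)
Definition syndrome (p n l : nat) (xs : l.-tuple 'rV['F_p]_(n + n))
    (e : 'rV['F_p]_(n + n)) : 'rV['F_p]_l :=
  \row_i sympl (tnth xs i) e.

(* The recovery operator U may depend on the syndrome s only; the phase c may
   depend on everything. *)
Definition can_correct (R : realType) (p n l : nat)
    (xs : l.-tuple 'rV['F_p]_(n + n)) (I : {set 'I_n})
    (Q : 'cV[R[i]]_(tdim p n) -> Prop) : Prop :=
  forall s : 'rV['F_p]_l,
    exists2 U : 'M[R[i]]_(tdim p n), U \is unitarymx &
      forall e, e \in supported p I -> syndrome xs e = s ->
      forall psi, Q psi ->
      exists2 c : R[i], `|c| = 1 & U *m (weyl R e *m psi) = c *: psi.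

(* Main.v *)
Require Import Defs.
From mathcomp Require Import all_boot all_order all_algebra.
From mathcomp Require Import complex ring.
From mathcomp Require Import reals trigo.

(* The operators satisfy M(x) M(y) = zeta^k M(x + y) for some k depending on x
   and y, and M(y) M(x) = zeta^<x, y> M(x) M(y), where zeta^t = 1 only for
   t = 0.

   If C and D^perp agree on F_p^I, two errors with the same syndrome differ by
   an element of C, so that M(e0)^-1 recovers from every error having the
   syndrome of e0.  Conversely, an error e in D^perp has the syndrome of 0, so
   correctability makes every codeword an eigenvector of M(e).  If e were not in
   C, there would be f in C^perp with <f, e> <> 0; then phi and M(f) phi are
   codewords with different eigenvalues under M(e), and their sum is a codeword
   that is not an eigenvector. *)

Set Implicit Arguments.
Unset Strict Implicit.
Unset Printing Implicit Defensive.

Import Order.TTheory GRing.Theory Num.Theory.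
Local Open Scope ring_scope.
Local Open Scope sesquilinear_scope.

(** * Exponents in ['F_p] and the root of unity [zeta] *)

Lemma val_FpD (p : nat) (hp : prime p) (t u : 'F_p) :
  (t + u : 'F_p) = ((t + u)%N %% p)%N :> nat.
(* The modulus built into the type ['F_p] is [p] only up to [Fp_cast], which needs [p] prime. *)
Proof. by congr (_ %% _)%N; apply: Fp_cast. Qed.

Lemma val_FpM (p : nat) (hp : prime p) (t u : 'F_p) :
  (t * u : 'F_p) = ((t * u)%N %% p)%N :> nat.
Proof. by congr (_ %% _)%N; apply: Fp_cast. Qed.

Lemma exprFpD (T : pzRingType) (p : nat) (hp : prime p) (x : T)
    (hx : x ^+ p = 1) (t u : 'F_p) :
  x ^+ (t + u)%R = x ^+ t * x ^+ u.
Proof. by rewrite val_FpD // expr_mod // exprD. Qed.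

Lemma exprFpM (T : pzRingType) (p : nat) (hp : prime p) (x : T)
    (hx : x ^+ p = 1) (t u : 'F_p) :
  x ^+ (t * u)%R = x ^+ (t * u)%N.
Proof. by rewrite val_FpM // expr_mod. Qed.

Lemma exprFp_sum (T : comPzRingType) (p : nat) (hp : prime p) (x : T)
    (hx : x ^+ p = 1) (I : finType) (F : I -> 'F_p) :
  x ^+ (\sum_i F i)%R = \prod_i x ^+ F i.
Proof.
by apply: (big_morph (fun t : 'F_p => x ^+ t)) => // t u; rewrite exprFpD.
Qed.

Lemma zetaX (R : realType) (p k : nat) :
  zeta R p ^+ k = Complex (cos (2 * pi / p%:R *+ k)) (sin (2 * pi / p%:R *+ k)).
Proof.
rewrite /zeta; set t := 2 * pi / _; elim: k => [|k IHk].
  by rewrite expr0 mulr0n cos0 sin0.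
rewrite exprS IHk mulrS cosD sinD.
by apply/eqP; rewrite eq_complex /= eqxx addrC eqxx.
Qed.

Lemma zeta_pexp (R : realType) (p : nat) (hp : (0 < p)%N) : zeta R p ^+ p = 1.
Proof.
rewrite zetaX -mulr_natr divfK ?pnatr_eq0 -?lt0n //.
by rewrite mulr_natl cos2pi sin2pi.
Qed.

Lemma zeta_neq1 (R : realType) (p : nat) (hp : (1 < p)%N) : zeta R p != 1.
Proof.
have p0 : 0 < p%:R :> R by rewrite ltr0n ltnW.
have t0 : 0 < 2 * pi / p%:R :> R.
  by rewrite divr_gt0 ?mulr_gt0 ?pi_gt0.
apply/eqP => -[cos1 _]; move: (t0).
have -> : 2 * pi / p%:R = 0 :> R; last by rewrite ltxx.
(* Since [p] is at least 2, the angle lies between 0 and [pi], where the cosine is injective. *)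
apply: cos_inj; rewrite ?cos0 // in_itv /= ?lexx ?pi_ge0 //.
by rewrite ltW //= ler_pdivrMr // mulrC ler_wpM2l ?pi_ge0 // ler_nat.
Qed.

Lemma norm_root1 (R : numDomainType) (p : nat) (x : R) (hp : (0 < p)%N)
  (hx : x ^+ p = 1) : `|x| = 1.
Proof. by apply/eqP; rewrite -(@pexpr_eq1 _ _ p) // -normrX hx normr1. Qed.

(** For nonzero [t], raising [zeta R p ^+ t] to the inverse of [t] in ['F_p] gives back [zeta R p],
    which is not 1. *)
Lemma zetaFp_eq1 (R : realType) (p : nat) (hp : prime p) (t : 'F_p) :
  (zeta R p ^+ t == 1) = (t == 0).
Proof.
have z1 := zeta_pexp R (prime_gt0 hp).
apply/eqP/eqP => [zt1|->//]; apply/eqP; apply: contraTT (isT) => t0.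
suff : zeta R p == 1 by rewrite (negPf (zeta_neq1 R (prime_gt1 hp))).
have -> : zeta R p = zeta R p ^+ (t * t^-1)%R.
  by rewrite divff //= expr1.
by rewrite exprFpM // exprM zt1 expr1n.
Qed.

(** * Tensor products of matrices *)

Lemma tensorM (K : comPzRingType) (p n : nat) (A B : 'I_n -> 'M[K]_p) :
  tensor A *m tensor B = tensor (fun i => A i *m B i).
Proof.
apply/matrixP => k l; rewrite !mxE.
under [RHS]eq_bigr do rewrite mxE.
(* Distributivity turns the product of sums over intermediate digits into one sum over digit
   functions, which [digits] matches with the indices. *)
rewrite bigA_distr_bigA (reindex (@digits p n)) /=; last first.
  exact/onW_bij/enum_val_bij.
by apply: eq_bigr => j _; rewrite !mxE -big_split.
Qed.

Lemma tensorZ (K : comPzRingType) (p n : nat) (c : 'I_n -> K)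
    (A : 'I_n -> 'M[K]_p) :
  tensor (fun i => c i *: A i) = (\prod_i c i) *: tensor A.
Proof.
apply/matrixP => k l; rewrite !mxE -big_split /=.
by apply: eq_bigr => i _; rewrite mxE.
Qed.

Lemma tensor1 (K : comPzRingType) (p n : nat) :
  tensor (fun _ : 'I_n => 1%:M : 'M[K]_p) = 1%:M.
Proof.
apply/matrixP => k l; rewrite !mxE; have [->|kl] := eqVneq k l.
  by rewrite big1 // => i _; rewrite mxE eqxx.
have /existsP[i di] : [exists i, digits k i != digits l i].
  apply: contraNT kl; rewrite negb_exists => /forallP dkl.
  by apply/eqP/enum_val_inj/ffunP => i; apply/eqP; rewrite -[_ == _]negbK.
by rewrite (bigD1 i) //= mxE (negPf di) mul0r.
Qed.

Lemma eq_tensor (K : comPzRingType) (p n : nat) (A B : 'I_n -> 'M[K]_p) :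
  A =1 B -> tensor A = tensor B.
Proof.
by move=> AB; apply/matrixP => k l; rewrite !mxE; apply: eq_bigr => i; rewrite AB.
Qed.

Lemma tensor_unitary (K : numClosedFieldType) (p n : nat) (A : 'I_n -> 'M[K]_p) :
  (forall i, A i \is unitarymx) -> tensor A \is unitarymx.
Proof.
move=> Au; apply/unitarymxP.
have -> : (tensor A)^t* = tensor (fun i => (A i)^t*).
  apply/matrixP => k l; rewrite !mxE rmorph_prod.
  by apply: eq_bigr => i _; rewrite !mxE.
rewrite tensorM -[RHS]tensor1; apply: eq_tensor => i.
exact/unitarymxP.
Qed.

(** * Powers of matrices, and the operators X and Z *)

Lemma expr_unitarymx (K : numClosedFieldType) (p k : nat) (A : 'M[K]_p) :
  A \is unitarymx -> A ^+ k \is unitarymx.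
Proof.
move=> Au; elim: k => [|k IHk]; last by rewrite exprS mul_unitarymx.
by apply/unitarymxP; rewrite expr0 trmx1 map_mx1 mul1mx.
Qed.

(** Each of the [b] factors [B] passes each of the [a] factors [A] at the cost of one [c]. *)
Lemma exprmx_twisted_comm (K : comPzRingType) (p a b : nat) (c : K)
    (A B : 'M[K]_p) :
  B *m A = c *: (A *m B) ->
  B ^+ b *m A ^+ a = c ^+ (b * a) *: (A ^+ a *m B ^+ b).
Proof.
move=> BA.
have BAa : B *m A ^+ a = c ^+ a *: (A ^+ a *m B).
  elim: a => [|a IHa]; first by rewrite !expr0 mulmx1 mul1mx scale1r.
  rewrite !exprS -!mulmxE mulmxA BA -scalemxAl -!mulmxA IHa.
  by rewrite -scalemxAr scalerA.
elim: b => [|b IHb]; first by rewrite !expr0 mulmx1 mul1mx scale1r.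
rewrite exprS -mulmxE -mulmxA IHb -scalemxAr (mulmxA B) BAa -scalemxAl scalerA.
by rewrite -exprD mulSn addnC mulmxA.
Qed.

Lemma mulmx_twisted_comm (K : comPzRingType) (p a b a' b' : nat) (c : K)
    (A B : 'M[K]_p) :
  B *m A = c *: (A *m B) ->
  (A ^+ a *m B ^+ b) *m (A ^+ a' *m B ^+ b') =
  c ^+ (b * a') *: (A ^+ (a + a') *m B ^+ (b + b')).
Proof.
move=> BA; rewrite mulmxA -[_ *m _ *m (A ^+ a')]mulmxA.
rewrite (exprmx_twisted_comm _ _ BA) -scalemxAr -!scalemxAl.
by rewrite !exprD -!mulmxE !mulmxA.
Qed.

Lemma diag_mx_expr (K : comPzRingType) (p k : nat) (d : 'rV[K]_p) :
  diag_mx d ^+ k = diag_mx (\row_i d 0 i ^+ k).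
Proof.
elim: k => [|k IHk].
  by apply/matrixP => i j; rewrite expr0 !mxE expr0.
rewrite exprS IHk -mulmxE mul_diag_mx; apply/matrixP => i j.
by rewrite !mxE exprS mulrnAr.
Qed.

Lemma phaseZ_pexp (R : realType) (p : nat) (hp : (0 < p)%N) :
  phaseZ R p ^+ p = 1%:M.
Proof.
rewrite diag_mx_expr; apply/matrixP => i j; rewrite !mxE.
by rewrite -exprM mulnC exprM zeta_pexp // expr1n.
Qed.

Lemma shiftX_expr (R : realType) (p k : nat) :
  shiftX R p ^+ k = \matrix_(i, j) (i == iter k (@ordS p) j)%:R.
Proof.
elim: k => [|k IHk]; first by apply/matrixP => i j; rewrite expr0 !mxE.
rewrite exprS IHk -mulmxE; apply/matrixP => i j; rewrite !mxE.
rewrite (bigD1 (iter k (@ordS p) j)) //= !mxE eqxx mulr1 big1 ?addr0 //.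
by move=> l /negPf lj; rewrite !mxE lj mulr0.
Qed.

Lemma shiftX_pexp (R : realType) (p : nat) : shiftX R p ^+ p = 1%:M.
Proof.
rewrite shiftX_expr; apply/matrixP => i j; rewrite !mxE.
have iterE k : iter k (@ordS p) j = ((j + k) %% p)%N :> nat.
  elim: k => [|k IHk]; first by rewrite addn0 modn_small.
  by rewrite iterS /= IHk addnS -addn1 modnDml addn1.
congr (_ == _)%:R; apply: val_inj => /=.
by rewrite iterE modnDr modn_small.
Qed.

Lemma phaseZ_shiftX (R : realType) (p : nat) (hp : (0 < p)%N) :
  phaseZ R p *m shiftX R p = zeta R p *: (shiftX R p *m phaseZ R p).
Proof.
rewrite mul_diag_mx mul_mx_diag; apply/matrixP => i j; rewrite !mxE.
case: eqP => [->|_]; last by rewrite !(mulr0, mul0r).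
(* Only the entries with [i = ordS j] survive; the wrap from p - 1 to 0 is harmless because
   [zeta R p ^+ p = 1]. *)
by rewrite mulr1 mul1r /= expr_mod ?zeta_pexp // exprS.
Qed.

Lemma shiftX_unitary (R : realType) (p : nat) : shiftX R p \is unitarymx.
Proof.
apply/unitarymxP/matrixP => i j; rewrite !mxE.
rewrite (bigD1 (ord_pred i)) //= !mxE ord_predK eqxx mul1r big1 ?addr0.
  by rewrite conjC_nat eq_sym.
move=> k; rewrite !mxE; case: (i =P ordS k) => [->|_ _]; last by rewrite mul0r.
by rewrite ordSK eqxx.
Qed.

Lemma phaseZ_unitary (R : realType) (p : nat) (hp : (0 < p)%N) :
  phaseZ R p \is unitarymx.
Proof.
apply/unitarymxP; rewrite tr_diag_mx map_diag_mx mulmx_diag.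
apply/matrixP => i j; rewrite !mxE -normCK normrX.
by rewrite (norm_root1 hp (zeta_pexp R hp)) !expr1n.
Qed.

(** * The operators M(x): products and commutation *)

Lemma weyl_unitary (R : realType) (p n : nat) (hp : (0 < p)%N)
    (x : 'rV['F_p]_(n + n)) : weyl R x \is unitarymx.
Proof.
by apply: tensor_unitary => i; rewrite mul_unitarymx ?expr_unitarymx
  ?shiftX_unitary ?phaseZ_unitary.
Qed.

(** In each tensor factor, the phase arises from moving the power of Z in M(x) past the power of X
    in M(y). *)
Lemma weylD (R : realType) (p n : nat) (hp : prime p)
    (x y : 'rV['F_p]_(n + n)) :
  weyl R x *m weyl R y =
  zeta R p ^+ (\sum_i rsubmx x 0 i * lsubmx y 0 i)%R *: weyl R (x + y).
Proof.
have p0 := prime_gt0 hp; have z1 := zeta_pexp R p0.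
rewrite exprFp_sum // tensorM -tensorZ; apply: eq_tensor => i.
have -> : lsubmx (x + y) 0 i = lsubmx x 0 i + lsubmx y 0 i by rewrite !mxE.
have -> : rsubmx (x + y) 0 i = rsubmx x 0 i + rsubmx y 0 i by rewrite !mxE.
rewrite (mulmx_twisted_comm _ _ _ _ (phaseZ_shiftX R p0)) exprFpM //.
by rewrite !val_FpD // !expr_mod ?shiftX_pexp ?phaseZ_pexp.
Qed.

(** By [weylD] both products are multiples of M(x + y), and the exponents of their phases differ by
    [sympl x y]. *)
Lemma weylC (R : realType) (p n : nat) (hp : prime p)
    (x y : 'rV['F_p]_(n + n)) :
  weyl R y *m weyl R x = zeta R p ^+ sympl x y *: (weyl R x *m weyl R y).
Proof.
have z1 := zeta_pexp R (prime_gt0 hp).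
have symE : \sum_i rsubmx y 0 i * lsubmx x 0 i =
            sympl x y + \sum_i rsubmx x 0 i * lsubmx y 0 i.
  by rewrite /sympl -big_split; apply: eq_bigr => i _ /=; ring.
by rewrite (weylD R hp y x) (weylD R hp x y) scalerA symE (exprFpD hp z1) (addrC y).
Qed.

(** * The symplectic form, orthogonal spaces and supports *)

Lemma mem_perp (p n : nat) (C : {vspace 'rV['F_p]_(n + n)}) x :
  reflect (forall y, y \in C -> sympl y x = 0) (x \in perp C).
Proof.
rewrite inE; apply: (iffP forallP) => [Cx y yC|Cx y].
  by have := Cx y; rewrite yC => /eqP.
by apply/implyP => /Cx ->.
Qed.

Lemma symplB (p n : nat) (x y z : 'rV['F_p]_(n + n)) :
  sympl x (y - z) = sympl x y - sympl x z.
Proof.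
rewrite /sympl -sumrB; apply: eq_bigr => i _.
by rewrite !mxE; ring.
Qed.

Lemma sympl_antisym (p n : nat) (x y : 'rV['F_p]_(n + n)) : sympl y x = - sympl x y.
Proof. by rewrite /sympl -sumrN; apply: eq_bigr => i _; rewrite opprB. Qed.

Lemma sympl_suml (p n m : nat) (k : 'I_m -> 'F_p)
    (x : 'I_m -> 'rV['F_p]_(n + n)) (y : 'rV['F_p]_(n + n)) :
  sympl (\sum_i k i *: x i) y = \sum_i k i * sympl (x i) y.
Proof.
rewrite /sympl; under [RHS]eq_bigr do rewrite mulr_sumr.
rewrite exchange_big /=; apply: eq_bigr => i _.
rewrite !mxE !summxE mulr_suml mulr_sumr -sumrB; apply: eq_bigr => j _.
by rewrite !mxE; ring.
Qed.

Lemma perp_basis (p n l : nat) (D : {vspace 'rV['F_p]_(n + n)})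
    (xs : l.-tuple 'rV['F_p]_(n + n)) (hxs : basis_of D xs) e :
  (e \in perp D) = (syndrome xs e == 0).
Proof.
apply/mem_perp/eqP => [De|xe y yD].
  apply/rowP => i; rewrite !mxE De //.
  by rewrite (basis_mem hxs) // mem_tnth.
rewrite (coord_basis hxs yD) sympl_suml big1 // => i _.
by move/rowP/(_ i): xe; rewrite !mxE (tnth_nth 0) => ->; rewrite mulr0.
Qed.

Lemma supportedB (p n : nat) (I : {set 'I_n}) (x y : 'rV['F_p]_(n + n)) :
  x \in supported p I -> y \in supported p I -> x - y \in supported p I.
Proof.
rewrite !inE => /forallP xI /forallP yI; apply/forallP => i; apply/implyP => iI.
have := xI i; have := yI i; rewrite iI !mxE /=.
by move=> /andP[/eqP-> /eqP->] /andP[/eqP-> /eqP->]; rewrite subrr eqxx.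
Qed.

Lemma supported0 (p n : nat) (I : {set 'I_n}) :
  (0 : 'rV['F_p]_(n + n)) \in supported p I.
Proof. by rewrite inE; apply/forallP => i; rewrite !mxE eqxx implybT. Qed.

(** This is the nondegeneracy of the form: the vector is obtained from [g] by swapping its halves,
    with one sign change. *)
Lemma sympl_linear_form (p n : nat) (g : 'I_(n + n) -> 'F_p) :
  exists f, forall x : 'rV['F_p]_(n + n), sympl x f = \sum_i x 0 i * g i.
Proof.
exists (row_mx (\row_i - g (rshift n i)) (\row_i g (lshift n i))) => x.
rewrite big_split_ord /= -big_split /=; apply: eq_bigr => i _.
by rewrite row_mxKl row_mxKr !mxE mulNr opprK [g _ * _]mulrC.
Qed.

(* Half of [C^perp^perp = C]: the separating functional is a coordinate of
   [x - projv C x]. *)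
Lemma perp_separates (p n : nat) (C : {vspace 'rV['F_p]_(n + n)})
    (e : 'rV['F_p]_(n + n)) :
  e \notin C -> exists2 f, f \in perp C & sympl e f != 0.
Proof.
move=> eC; pose h x := x - projv C x.
have /rV0Pn[j hj] : h e != 0.
  by apply: contraNneq eC => /subr0_eq he; rewrite he memv_proj.
have [f fE] := sympl_linear_form (fun i => h (delta_mx 0 i) 0 j).
have {}fE x : sympl x f = h x 0 j.
  rewrite fE {2}[x]row_sum_delta /h linear_sum -sumrB summxE.
  by apply: eq_bigr => i _; rewrite linearZ /= -scalerBr [RHS]mxE.
exists f; last by rewrite fE.
by apply/mem_perp => y yC; rewrite fE /h projv_id // subrr mxE.
Qed.

(** * Action on codewords and eigenvectors *)

Lemma weyl0 (R : realType) (p n : nat) :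
  weyl R (0 : 'rV['F_p]_(n + n)) = 1%:M.
Proof.
rewrite -[RHS]tensor1; apply: eq_tensor => i.
by rewrite !mxE !expr0 mulmx1.
Qed.

Lemma unitarymx_eigenvalue_norm (K : numClosedFieldType) (m : nat) (U : 'M[K]_m)
    (v : 'cV[K]_m) (c : K) :
  U \is unitarymx -> v != 0 -> U *m v = c *: v -> `|c| = 1.
Proof.
move=> /unitarymxP/mulmx1C Uu v0 Uv.
have v2 : (v^t* *m v) 0 0 != 0.
  (* [dotmx] pairs row vectors, so the column [v] enters through its conjugate transpose. *)
  rewrite -[v in X in _ *m X]trmxCK -dotmxE dnorm_eq0.
  by apply: contraNneq v0 => v1; rewrite -[v]trmxCK v1 trmx0 map_mx0.
apply/eqP; rewrite -(@pexpr_eq1 _ _ 2) // normCK.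
apply/eqP/(mulIf v2); rewrite mul1r.
have := congr1 (fun w => (w^t* *m w) 0 0) Uv.
rewrite trmx_mul map_mxM -mulmxA [U^t* *m _]mulmxA Uu mul1mx => vE.
have cvE : (c *: v)^t* = c^* *: v^t*.
  by apply/matrixP => i j; rewrite !mxE rmorphM.
by rewrite [RHS]vE cvE -scalemxAl -scalemxAr scalerA [RHS]mxE [c * _]mulrC.
Qed.

Lemma weyl_unitmx (R : realType) (p n : nat) (hp : (0 < p)%N)
    (x : 'rV['F_p]_(n + n)) : weyl R x \in unitmx.
Proof. exact/unitarymx_unit/weyl_unitary. Qed.

Lemma weyl_perp_code (R : realType) (p n : nat) (hp : prime p)
    (C : {vspace 'rV['F_p]_(n + n)}) (eta : 'M[R[i]]_(tdim p n) -> R[i])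
    (psi : 'cV[R[i]]_(tdim p n)) (f : 'rV['F_p]_(n + n)) :
  f \in perp C -> stab_code C eta psi -> stab_code C eta (weyl R f *m psi).
Proof.
move=> /mem_perp fC Qpsi U SU.
suff Uf : U *m weyl R f = weyl R f *m U.
  by rewrite mulmxA Uf -mulmxA Qpsi // scalemxAr.
elim: U / SU => [x xC||U V _ IU _ IV|U _ IU].
- by rewrite [RHS]weylC // fC // expr0 scale1r.
- by rewrite mul1mx mulmx1.
- by rewrite -mulmxA IV mulmxA IU mulmxA.
(* On a singular matrix [invmx] is the identity map, so that case is the induction hypothesis. *)
have [Uu|/invmx_out->//] := boolP (U \in unitmx).
by rewrite -[LHS](mulmxK Uu) -(mulmxA (invmx U)) -IU mulKmx.
Qed.

Lemma correctable_syndrome0 (R : realType) (p n l : nat) (hp : prime p)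
    (xs : l.-tuple 'rV['F_p]_(n + n)) (I : {set 'I_n})
    (Q : 'cV[R[i]]_(tdim p n) -> Prop) (e : 'rV['F_p]_(n + n)) :
  can_correct xs I Q -> e \in supported p I -> syndrome xs e = 0 ->
  forall psi, Q psi -> exists c, weyl R e *m psi = c *: psi.
Proof.
move=> /(_ 0)[U Uu corr] eI e0 psi Qpsi.
have xs0 : syndrome xs 0 = 0.
  by apply/rowP => i; rewrite !mxE /sympl big1 // => j _; rewrite !mxE; ring.
have [c c1 cE] := corr e eI e0 psi Qpsi.
have [d d1 dE] := corr 0 (supported0 p I) xs0 psi Qpsi.
have d0 : d != 0 by rewrite -normr_eq0 d1 oner_neq0.
move: dE; rewrite weyl0 mul1mx => dE.
(* The same [U] sends [weyl R e *m psi] to [c *: psi] and, for the error 0, [psi] to [d *: psi]. *)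
exists (c / d); apply: (can_inj (mulKmx (unitarymx_unit Uu))).
by rewrite cE -scalemxAr dE scalerA divfK.
Qed.

(** The hypotheses give [(a - d) *: v = (d - b) *: w]. Applying [A] multiplies the left side by [a]
    and the right side by [b], whence [(a - d) * (a - b) = 0]; if [a = d], then [w != 0] forces
    [d = b]. *)
Lemma eigenvector_sum_eq (K : fieldType) (m : nat) (A : 'M[K]_m)
    (v w : 'cV[K]_m) (a b d : K) :
  v != 0 -> w != 0 -> A *m v = a *: v -> A *m w = b *: w ->
  A *m (v + w) = d *: (v + w) -> a = b.
Proof.
move=> v0 w0 Av Aw; rewrite mulmxDr Av Aw scalerDr => Avw.
have vw : (a - d) *: v = (d - b) *: w.
  by apply/eqP; rewrite !scalerBl subr_eq addrAC [_ + d *: v]addrC -Avw addrK.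
have : (a - d) * (a - b) == 0.
  have := congr1 (mulmx A) vw; rewrite -!scalemxAr Av Aw !scalerA.
  rewrite [_ * b]mulrC -(scalerA b) -vw scalerA => /eqP.
  rewrite -subr_eq0 -scalerBl scaler_eq0 (negPf v0) orbF.
  by rewrite [b * _]mulrC -mulrBr.
rewrite mulf_eq0 => /orP[|]; rewrite subr_eq0 => /eqP // ad.
move: vw; rewrite ad subrr scale0r => /esym/eqP.
by rewrite scaler_eq0 (negPf w0) orbF subr_eq0 => /eqP.
Qed.

Theorem theorem3 (R : realType) (p n : nat) (hp : prime p) (hn : (0 < n)%N)
    (C : {vspace 'rV['F_p]_(n + n)}) (hC : [set x in C] \subset perp C)
    (eta : 'M[R[i]]_(tdim p n) -> R[i]) (phi : 'cV[R[i]]_(tdim p n))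
    (hphi : stab_eigenvector C eta phi)
    (I : {set 'I_n}) (D : {vspace 'rV['F_p]_(n + n)}) (hD : (D <= C)%VS)
    (l : nat) (xs : l.-tuple 'rV['F_p]_(n + n)) (hxs : basis_of D xs) :
  can_correct xs I (stab_code C eta) <->
  [set x in C] :&: supported p I = perp D :&: supported p I.
Proof.
have p0 := prime_gt0 hp; have z1 := zeta_pexp R p0.
have [phi0 Qphi] := hphi.
(* [C] lies in [perp C], which lies in [perp D] because [D] lies in [C]. *)
have CD x : x \in C -> x \in perp D.
  move=> xC; apply/mem_perp => y /(subvP hD) yC.
  have /mem_perp : x \in perp C by rewrite (subsetP hC) // inE.
  by apply.
split=> [corr | CDI s].
  apply/setP => e; rewrite !in_setI [e \in [set _ in _]]inE.
  have [eI|_] := boolP (e \in supported p I); rewrite ?andbF // !andbT.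
  apply/idP/idP => [/CD//|]; rewrite (perp_basis hxs) => /eqP e0.
  have scal := correctable_syndrome0 hp corr eI e0.
  apply: contraT => /perp_separates[f fC fe].
  have Qf := weyl_perp_code hp fC Qphi; set phi' := weyl R f *m phi in Qf.
  have [c cE] := scal _ Qphi.
  have [d dE] : exists d, weyl R e *m (phi + phi') = d *: (phi + phi').
    by apply: scal => U SU; rewrite mulmxDr Qphi // Qf // scalerDr.
  (* This allows cancelling [c] in the equality [c = z * c] that [eigenvector_sum_eq] yields
     below. *)
  have c0 : c != 0.
    rewrite -normr_eq0 (unitarymx_eigenvalue_norm (weyl_unitary R p0 e) phi0 cE).
    exact: oner_neq0.
  have phi'0 : phi' != 0.
    apply: contraNneq phi0 => phi'0.
    by rewrite -(mulKmx (weyl_unitmx R p0 f) phi) -/phi' phi'0 mulmx0.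
  pose z := zeta R p ^+ sympl f e.
  have z_neq1 : z != 1 by rewrite zetaFp_eq1 // sympl_antisym oppr_eq0.
  have c'E : weyl R e *m phi' = (z * c) *: phi'.
    by rewrite mulmxA (weylC R hp f e) -scalemxAl -mulmxA cE -scalemxAr scalerA.
  have := eigenvector_sum_eq phi0 phi'0 cE c'E dE.
  rewrite -{1}[c]mul1r => /(mulIf c0) /esym/eqP.
  by rewrite (negPf z_neq1).
have [/existsP[e0 /andP[e0I /eqP e0s]]|none] :=
  boolP [exists e, (e \in supported p I) && (syndrome xs e == s)]; last first.
  (* No error supported on [I] has the syndrome [s], so any unitary will do. *)
  exists 1%:M; first by apply/unitarymxP; rewrite trmx1 map_mx1 mul1mx.
  move=> e eI es; case/negP: none; apply/existsP; exists e.
  by rewrite eI es eqxx.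
exists (invmx (weyl R e0)).
  by rewrite invmx_unitary ?weyl_unitary // trmxC_unitary weyl_unitary.
move=> e eI es psi Qpsi.
have eC : e - e0 \in C.
  have : e - e0 \in [set x in C] :&: supported p I.
    rewrite CDI in_setI supportedB // andbT (perp_basis hxs).
    apply/eqP/rowP => i; move/rowP/(_ i): es; move/rowP/(_ i): e0s.
    by rewrite !mxE symplB => <- ->; rewrite subrr.
  by rewrite !inE => /andP[].
(* The phase given by [weylD] for the decomposition of [e] as [e0 + (e - e0)]. *)
set w := zeta R p ^+ (\sum_i rsubmx e0 0 i * lsubmx (e - e0)%R 0 i)%R.
have w1 : `|w| = 1 by rewrite normrX (norm_root1 p0 z1) expr1n.
have w0 : w != 0 by rewrite -normr_eq0 w1 oner_neq0.
have eE : weyl R e = w^-1 *: (weyl R e0 *m weyl R (e - e0)).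
  by rewrite weylD // -/w scalerA mulVf // scale1r addrC subrK.
have SC : stab_group C (weyl R (e - e0)) by apply: stab_gen.
exists (w^-1 * eta (weyl R (e - e0))).
  rewrite normrM normfV w1 invr1 mul1r.
  (* The norm of the eigenvalue is read off from [phi], since [psi] may be zero. *)
  exact: unitarymx_eigenvalue_norm (weyl_unitary R p0 _) phi0 (Qphi _ SC).
rewrite eE -scalemxAl -scalemxAr -mulmxA mulKmx ?weyl_unitmx //.
by rewrite Qpsi // scalerA.
Qed.
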